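(* Let $G$ be a finite connected simple graph with $n$ vertices and $m$ edges, and let $k\ge 1$ be an integer. Then \[HM(S_k(G))=F(G)+4M_1(G)+16km-8m.\]
   Context: For a graph $H$ and vertex $v$, $d_H(v)$ denotes the degree of $v$ in $H$. Define $M_1(H)=\sum_{v\in V(H)} d_H(v)^2$, $F(H)=\sum_{v\in V(H)} d_H(v)^3$, and the hyper Zagreb index $HM(H)=\sum_{uv\in E(H)}(d_H(u)+d_H(v))^2$. The $k$-th subdivision graph $S_k(G)$ is the graph obtained from $G$ by inserting $k$ new vertices into each edge of $G$, i.e. each edge $uv$ of $G$ is replaced by a path from $u$ to $v$ with $k$ new internal vertices (distinct for distinct edges). *)

(* Defs.v *)
From HB Require Import structures.
From mathcomp Require Import all_boot all_order all_algebra.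

Set Implicit Arguments.
Unset Strict Implicit.
Unset Printing Implicit Defensive.

Record sgraph := SGraph {
  vertex :> finType;
  adj : rel vertex;
  adj_sym : symmetric adj;
  adj_irrefl : irreflexive adj
}.

Definition edges (G : sgraph) : {set {set G}} :=
  [set [set p.1; p.2] | p : G * G & adj p.1 p.2].

Definition connected_graph (G : sgraph) : bool :=
  (0 < #|G|) && [forall x : G, forall y : G, connect (@adj G) x y].

Definition degree (G : sgraph) (v : G) : nat := #|[set w : G | adj v w]|.

Definition first_zagreb (G : sgraph) : nat := \sum_(v : G) degree v ^ 2.

Definition forgotten (G : sgraph) : nat := \sum_(v : G) degree v ^ 3.

(* An edge is the two-element set of its ends, so the inner sum is
   d(u) + d(v) for e = uv. *)
Definition hyper_zagreb (G : sgraph) : nat :=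
  \sum_(e in edges G) (\sum_(v in e) degree v) ^ 2.

Definition edge_type (G : sgraph) : finType := {e : {set G} | e \in edges G}.

Section Subdivision.
Variables (k : nat) (G : sgraph).

(* The vertex inr (e, i) is the i-th new vertex inserted into the edge e. *)
Definition subdiv_vertex : finType := (G + edge_type G * 'I_k)%type.

(* The path replacing e.  It runs from one end of e to the other in the order
   in which enum lists them; the opposite orientation gives an isomorphic
   graph.  The default branch is never taken, by enum_edge below. *)
Definition subdiv_path (e : edge_type G) : seq subdiv_vertex :=
  if enum (val e) is [:: u; v] then
    inl u :: rcons [seq inr (e, i) | i <- enum 'I_k] (inl v)
  else [::].

Definition subdiv_adj : rel subdiv_vertex := fun x y =>
  [exists e : edge_type G,
    infix [:: x; y] (subdiv_path e) || infix [:: y; x] (subdiv_path e)].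

Lemma enum_edge (e : edge_type G) :
  exists u v : G, [/\ adj u v, val e = [set u; v] & enum (val e) = [:: u; v]].
Proof.
case: e => s /= /imsetP [[x y]]; rewrite inE /= => Hxy Es.
have nxy : x != y by apply: contraTneq Hxy => ->; rewrite adj_irrefl.
have := cards2 x y; rewrite nxy -Es cardE.
have := enum_uniq s; have := mem_enum s.
case: (enum s) => [|u [|v []]] //= Hmem /andP []; rewrite inE => nuv _ _.
have Hu : u \in [set x; y] by rewrite -Es -Hmem mem_head.
have Hv : v \in [set x; y] by rewrite -Es -Hmem !inE eqxx orbT.
exists u, v; split=> //.
- move: Hu Hv nuv; rewrite !inE.
  by case/orP => /eqP -> /orP [] /eqP -> //; rewrite ?eqxx // adj_sym.
- by apply/setP => z; rewrite -Hmem !inE.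
Qed.

Lemma subdiv_path_uniq (e : edge_type G) : uniq (subdiv_path e).
Proof.
rewrite /subdiv_path; have := enum_uniq (val e).
case: (enum (val e)) => [|u [|v []]] //= /andP []; rewrite inE => nuv _.
rewrite mem_rcons inE negb_or rcons_uniq map_inj_uniq ?enum_uniq; last first.
  by move=> i j [].
rewrite andbT -andbA; apply/and3P; split=> //.
- by apply/negP => /mapP [].
- by apply/negP => /mapP [].
Qed.

Lemma subdiv_adj_sym : symmetric subdiv_adj.
Proof. by move=> x y; apply: eq_existsb => e; rewrite orbC. Qed.

Lemma subdiv_adj_irrefl : irreflexive subdiv_adj.
Proof.
move=> x; apply/existsP => -[e]; rewrite orbb => /infixP [s [t Est]].
have := subdiv_path_uniq e; rewrite Est !cat_uniq /= inE eqxx.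
by rewrite !andbF.
Qed.

Definition subdivision : sgraph := SGraph subdiv_adj_sym subdiv_adj_irrefl.

End Subdivision.

(* Main.v *)
(** Each edge [uv] of [G] becomes a path whose inner vertices have degree 2,
    while the old vertices keep their degree.  Such a path has [k + 1] edges and
    contributes [(d u + 2)^2 + 16 (k - 1) + (2 + d v)^2] to the hyper Zagreb
    index.  Summing over the edges of [G], and using that a sum of
    [g u + g v] over all edges [uv] equals the sum of [d v * g v] over all
    vertices, gives the formula. *)
Require Import Defs.
From mathcomp Require Import all_boot all_order all_algebra.
From mathcomp Require Import zify ring.

Set Implicit Arguments.
Unset Strict Implicit.
Unset Printing Implicit Defensive.

Lemma sum_set2 (T : finType) (f : T -> nat) (x y : T) :
  x != y -> \sum_(z in [set x; y]) f z = f x + f y.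
Proof. by move=> nxy; rewrite big_setU1 ?inE //= big_set1. Qed.

Lemma adj_neq (G : sgraph) (u v : G) : adj u v -> u != v.
Proof. by apply: contraTneq => ->; rewrite adj_irrefl. Qed.

(** The map sending a neighbour [w] to [[set v; w]] is a bijection from the neighbours of [v] onto
    the edges containing [v]. *)
Lemma degree_sum_edges (G : sgraph) (v : G) :
  degree v = \sum_(e in edges G) (v \in e).
Proof.
rewrite -big_mkcondr sum1dep_card /degree /=.
have inj : {in [set w | adj v w] &, injective (fun w => [set v; w])}.
  move=> w w'; rewrite !inE => /adj_neq nvw _ Eww.
  have : w \in [set v; w'] by rewrite -Eww !inE eqxx orbT.
  by rewrite !inE eq_sym (negPf nvw) => /eqP.
rewrite -(card_in_imset inj); apply: eq_card => e; rewrite inE.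
apply/imsetP/andP => [[w] | [/imsetP [[x y]]]]; rewrite inE /=.
  move=> vw ->; split; last by rewrite !inE eqxx.
  by apply/imsetP; exists (v, w); rewrite ?inE.
move=> xy ->; rewrite !inE => /orP [] /eqP ->; first by exists y; rewrite ?inE.
by exists x; rewrite 1?setUC // inE adj_sym.
Qed.

(** Double counting of incidences: [g v] occurs once for each edge through [v]. *)
Lemma sum_edges_ends (G : sgraph) (g : G -> nat) :
  \sum_(e in edges G) \sum_(v in e) g v = \sum_(v : G) degree v * g v.
Proof.
transitivity (\sum_(e in edges G) \sum_(v : G) (v \in e) * g v).
  apply: eq_bigr => e _; rewrite [LHS]big_mkcond /=; apply: eq_bigr => v _.
  by case: (v \in e); rewrite ?mul1n ?mul0n.
rewrite exchange_big /=; apply: eq_bigr => v _.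
by rewrite degree_sum_edges big_distrl.
Qed.

Lemma infix2P (T : eqType) (x0 x y : T) (s : seq T) :
  reflect (exists2 j, j.+1 < size s & x = nth x0 s j /\ y = nth x0 s j.+1)
          (infix [:: x; y] s).
Proof.
apply: (iffP (@infixP _ [:: x; y] s)) => [[p [q ->]] | [j lt_j [-> ->]]].
  exists (size p); first by rewrite !size_cat /=; lia.
  by rewrite !nth_cat ltnn subnn (ltnNge (size p).+1) leqnSn subSnn.
exists (take j s), (drop j.+2 s).
rewrite -{1}(cat_take_drop j s) (drop_nth x0 (ltnW lt_j)).
by rewrite (drop_nth x0 lt_j).
Qed.

Section SubdividedEdges.
Variables (k : nat) (G : sgraph).
Local Notation S := (subdivision k.+1 G).

(** Indices [0] and [k.+2] give the old ends of [e], and those in between the new vertices.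
    Inserting [k.+1] vertices makes the default [inr (e, ord0)] available; it is returned only
    beyond [k.+2]. *)
Definition subdiv_node (e : edge_type G) (j : nat) : S :=
  nth (inr (e, ord0)) (subdiv_path k.+1 e) j.

Definition subdiv_edge (p : edge_type G * 'I_k.+2) : {set S} :=
  [set subdiv_node p.1 p.2; subdiv_node p.1 p.2.+1].

Lemma size_subdiv_path (e : edge_type G) : size (subdiv_path k.+1 e) = k.+3.
Proof.
have [u [v [_ _ Ee]]] := enum_edge e.
by rewrite /subdiv_path Ee /= size_rcons size_map size_enum_ord.
Qed.

Lemma subdiv_nodeS (e : edge_type G) (i : 'I_k.+1) :
  subdiv_node e i.+1 = inr (e, i).
Proof.
have [u [v [_ _ Ee]]] := enum_edge e.
rewrite /subdiv_node /subdiv_path Ee /= nth_rcons size_map size_enum_ord.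
by rewrite ltn_ord (nth_map ord0) ?size_enum_ord // nth_ord_enum.
Qed.

Lemma subdiv_node_ends (e : edge_type G) : exists u v : G,
  [/\ u != v, val e = [set u; v], subdiv_node e 0 = inl u
    & subdiv_node e k.+2 = inl v].
Proof.
have [u [v [/adj_neq uv Ev Ee]]] := enum_edge e; exists u, v; split=> //.
  by rewrite /subdiv_node /subdiv_path Ee.
rewrite /subdiv_node /subdiv_path Ee /= nth_rcons size_map size_enum_ord.
by rewrite ltnn eqxx.
Qed.

Lemma subdiv_node_eq (e : edge_type G) (i j : nat) :
  i < k.+3 -> j < k.+3 -> (subdiv_node e i == subdiv_node e j) = (i == j).
Proof.
by move=> lti ltj; rewrite nth_uniq ?size_subdiv_path ?subdiv_path_uniq.
Qed.

Lemma subdiv_node_inr (e e' : edge_type G) (i : 'I_k.+1) (j : nat) :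
  j < k.+3 -> (inr (e', i) == subdiv_node e j) = (e' == e) && (j == i.+1).
Proof.
move=> lt_j; have [<-|ne] /= := eqVneq e' e.
  by rewrite -subdiv_nodeS subdiv_node_eq 1?eq_sym // ltnS ltnW // ltnS.
have [u [v [_ _ E0 Ek]]] := subdiv_node_ends e.
case: j lt_j => [|j lt_j]; first by rewrite E0.
case: (ltngtP j k.+1) => [lt_jk | |->]; [|lia|by rewrite Ek].
rewrite (subdiv_nodeS e (Ordinal lt_jk)).
by apply: contraNF ne => /eqP [->].
Qed.

Lemma subdiv_node_neq (e : edge_type G) (j : 'I_k.+2) :
  subdiv_node e j != subdiv_node e j.+1.
Proof. by rewrite subdiv_node_eq; have := ltn_ord j; lia. Qed.

(** Every edge of [S] has a new vertex among its ends, because each edge of [G] receives at least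
    one; that vertex reveals [e]. *)
Lemma subdiv_edge_inj : injective subdiv_edge.
Proof.
move=> [e i] [e' j] Eij.
have sub x : (x \in subdiv_edge (e, i)) = (x \in subdiv_edge (e', j)).
  by rewrite Eij.
have lti := ltn_ord i; have ltj := ltn_ord j.
have Eee : e = e'.
  (* The new vertex of index [i.-1] is node [1] if [i = 0] and node [i] otherwise, hence an end of
     the edge in both cases. *)
  have lt_i1 : i.-1 < k.+1 by lia.
  have := sub (inr (e, Ordinal lt_i1)).
  rewrite !inE /= !subdiv_node_inr ?eqxx //=; try lia.
  by have [//|_ /=] := eqVneq e e'; lia.
rewrite -{}Eee {Eij e'} in sub *.
(* On a single path, [i] is [j] or [j + 1] and [j] is [i] or [i + 1], so they agree. *)
have := sub (subdiv_node e i); have := sub (subdiv_node e j).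
rewrite !inE /= !subdiv_node_eq; try lia.
by move=> H1 H2; congr (_, _); apply: val_inj => /=; lia.
Qed.

Lemma edges_subdivision : edges S = [set subdiv_edge p | p in setT].
Proof.
apply/setP => E; apply/imsetP/imsetP => [[[x y]] | [[e j] _ ->]].
  rewrite inE /= => /existsP [e /orP []] /(infix2P (inr (e, ord0))) [j];
    rewrite size_subdiv_path => lt_j [-> ->] ->;
    exists (e, Ordinal (lt_j : j < k.+2));
    rewrite ?in_setT //.
  by rewrite setUC.
exists (subdiv_node e j, subdiv_node e j.+1) => //; rewrite inE /=.
apply/existsP; exists e; apply/orP; left; apply/(infix2P (inr (e, ord0))).
by exists j => //; rewrite size_subdiv_path; have := ltn_ord j; lia.
Qed.

Lemma sum_edges_subdivision (f : {set S} -> nat) :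
  \sum_(E in edges S) f E =
  \sum_(e : edge_type G) \sum_(j < k.+2)
     f [set subdiv_node e j; subdiv_node e j.+1].
Proof.
rewrite edges_subdivision big_imset /=; last by move=> p q _ _ /subdiv_edge_inj.
by rewrite pair_big /=; apply: eq_bigl => p; rewrite inE.
Qed.

Lemma degree_subdivision (x : S) : degree x =
  \sum_(e : edge_type G) \sum_(j < k.+2)
     ((x == subdiv_node e j) + (x == subdiv_node e j.+1)).
Proof.
rewrite degree_sum_edges sum_edges_subdivision.
apply: eq_bigr => e _; apply: eq_bigr => j _; rewrite !inE.
by case: eqVneq => [->|_]; rewrite ?(negPf (subdiv_node_neq e j)).
Qed.

Lemma degree_subdivision_inr (e : edge_type G) (i : 'I_k.+1) :
  @degree S (inr (e, i)) = 2.
Proof.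
rewrite degree_subdivision (bigD1 e) //= [X in _ + X]big1 => [|e' ne].
  (* Node [i + 1] starts only segment [i + 1] and finishes only segment [i], so each of the two sums
     equals 1. *)
  rewrite addn0 big_split /= [X in X + _](bigD1 (lift ord0 i)) //=.
  rewrite [X in _ + X](bigD1 (widen_ord (leqnSn _) i)) //=.
  rewrite !subdiv_nodeS !eqxx !big1 // => j; rewrite -val_eqE /= /bump => nj;
    rewrite subdiv_node_inr ?eqxx /=; have := ltn_ord j; lia.
by apply: big1 => j _; rewrite !subdiv_node_inr 1?eq_sym ?(negPf ne) //;
  have := ltn_ord j; lia.
Qed.

Lemma sum_edge_type (f : {set G} -> nat) :
  \sum_(e : edge_type G) f (val e) = \sum_(e in edges G) f e.
Proof.
by rewrite (big_sub (fun e => e \in edges G)).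
Qed.

Lemma degree_subdivision_inl (v : G) : @degree S (inl v) = degree v.
Proof.
rewrite degree_subdivision degree_sum_edges -sum_edge_type.
apply: eq_bigr => e _; have [a [b [nab -> E0 Ek]]] := subdiv_node_ends e.
(* An old vertex can start only the first segment of a path and finish only the last one. *)
rewrite big_split /= big_ord_recl /= E0 big1 => [|j _]; last first.
  by rewrite subdiv_nodeS.
rewrite big_ord_recr /= Ek big1 => [|j _]; last by rewrite subdiv_nodeS.
rewrite !inE addn0 add0n.
have inlE w : (inl v == inl w :> S) = (v == w) by [].
rewrite !inlE.
by case: eqVneq => [->|_]; rewrite ?(negPf nab).
Qed.

Lemma hyper_zagreb_subdivision : hyper_zagreb S =
  forgotten G + 4 * first_zagreb G + (16 * k + 8) * #|edges G|.
Proof.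
(* With [k + 1] inner vertices a path contributes [(d a + 2)^2 + 16 k + (2 + d b)^2]; expanding the
   squares leaves the constant [16 k + 8]. *)
transitivity (\sum_(e : edge_type G)
    (\sum_(v in val e) (degree v ^ 2 + 4 * degree v) + (16 * k + 8))).
  rewrite /hyper_zagreb sum_edges_subdivision; apply: eq_bigr => e _.
  have [a [b [nab -> E0 Ek]]] := subdiv_node_ends e.
  rewrite sum_set2 //; under eq_bigr do rewrite sum_set2 ?subdiv_node_neq //.
  rewrite big_ord_recl big_ord_recr /= E0 Ek.
  rewrite (subdiv_nodeS e ord0) (subdiv_nodeS e ord_max).
  (* The [k] middle segments have both ends new, so each contributes [(2 + 2)^2]. *)
  under eq_bigr => j _.
    rewrite (subdiv_nodeS e (widen_ord (leqnSn _) j)).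
    rewrite (subdiv_nodeS e (lift ord0 j)) !degree_subdivision_inr.
    over.
  rewrite sum_nat_const card_ord !degree_subdivision_inr.
  by rewrite !degree_subdivision_inl; ring.
rewrite (sum_edge_type
  (fun e => \sum_(v in e) (degree v ^ 2 + 4 * degree v) + (16 * k + 8))).
rewrite big_split /= sum_edges_ends sum_nat_const [#|_| * _]mulnC; congr (_ + _).
rewrite /forgotten /first_zagreb big_distrr -big_split /=.
by apply: eq_bigr => v _; ring.
Qed.

End SubdividedEdges.

Theorem theorem2p6 (G : sgraph) (n m k : nat)
  (hconn : connected_graph G)
  (hn : #|G| = n)
  (hm : #|edges G| = m)
  (hk : (1 <= k)%N) :
  ((hyper_zagreb (subdivision k G))%:Z =
   (forgotten G)%:Z + 4%:Z * (first_zagreb G)%:Z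
   + 16%:Z * k%:Z * m%:Z - 8%:Z * m%:Z)%R.
Proof.
(* In terms of the predecessor, [16 (k + 1) - 8 = 16 k + 8]. *)
case: k hk => // k _; rewrite hyper_zagreb_subdivision hm.
by rewrite -[k.+1]addn1 !(PoszD, PoszM); ring.
Qed.
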